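(* Let $P$ be a finite nonempty set of $N$ jobs with colors in $\{0,1\}$ such that any two distinct jobs of the same color have distinct process temperatures. Let $N_c$ be the number of jobs of color $c\in\{0,1\}$, and let $\hat k\ge 0$ be an integer with $\hat{k} \leq \min\{N_0,N_1\}+2$ such that at least one schedule $S$ of $P$ with $C(S)\le\hat k$ exists. Then there exists an optimal schedule $S^* = (B_1,\ldots,B_{k+1})$, written as its sequence of blocks, with $k = C(S^* )\leq \hat{k}$ (optimal meaning that $T(S^* )\le T(S)$ for every schedule $S$ of $P$ with $C(S)\le \hat k$), such that the following properties hold: a) For each block $B_i = (p_{i_1},\ldots,p_{i_{n_i}})$, either $t(p_{i_j}) < t(p_{i_{j+1}})$ for all $j=1,\ldots,n_i-1$, or $t(p_{i_j}) > t(p_{i_{j+1}})$ for all $j=1,\ldots,n_i-1$. Additionally, each inner block $B_2,\ldots,B_k$ is sorted in increasing order, i.e. the first alternative holds for $i=2,\ldots,k$. b) For each pair of blocks $B_r,B_s$ with $r<s$ of the same color, $t_{\max}(B_r) < t_{\min}(B_s)$.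
   Context: A job $p$ is associated with a pair $(t(p),c(p))$, where $t(p)\in(0,\infty)$ is its process temperature and $c(p)\in\{0,1\}$ is its color. For a sequence of jobs $(p_1,\ldots,p_n)$ put $$C(p_1,\ldots,p_n) := \sum_{i=1}^{n-1}|c(p_{i+1})-c(p_i)|,\qquad T(p_1,\ldots,p_n) := \sum_{i=1}^{n-1}|t(p_{i+1})-t(p_i)|$$ (total number of color changes and total process temperature change). A schedule of $P$ is a sequence containing each job of $P$ exactly once. A block of a schedule $S$ is a maximal sequence of consecutive jobs in $S$ sharing the same color; a schedule with exactly $k$ color changes is uniquely partitioned into $k+1$ consecutive blocks $B_1,\ldots,B_{k+1}$. For a block $B$, $t_{\max}(B)$ and $t_{\min}(B)$ denote the maximum and minimum process temperature of the jobs in $B$. *)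

(* Defs.v *)
From HB Require Import structures.
From mathcomp Require Import all_boot all_order all_algebra.
From mathcomp Require Import reals.

Set Implicit Arguments.
Unset Strict Implicit.
Unset Printing Implicit Defensive.

Import Order.TTheory GRing.Theory Num.Theory.

Local Open Scope ring_scope.

(* The set of jobs is a finite type J, with t : J -> R and c : J -> bool;
   color 0 is false and color 1 is true. *)

(* zip s (behead s) lists the pairs (p_i, p_{i+1}), 1 <= i <= n - 1; the colors
   are read as the naturals 0 and 1, whose distance is taken in int. *)
Definition color_changes (J : finType) (c : J -> bool) (s : seq J) : nat :=
  (\sum_(e <- zip s (behead s)) `|c e.2 - c e.1|)%N.

Definition temp_change (R : realType) (J : finType) (t : J -> R) (s : seq J) :
    R :=
  \sum_(e <- zip s (behead s)) `|t e.2 - t e.1|.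

Definition is_schedule (J : finType) (s : seq J) : Prop :=
  forall p : J, count_mem p s = 1%N.

Definition num_color (J : finType) (c : J -> bool) (b : bool) : nat :=
  #|[pred p | c p == b]|.

Definition optimal_schedule (R : realType) (J : finType) (t : J -> R)
    (c : J -> bool) (khat : nat) (s : seq J) : Prop :=
  [/\ is_schedule s, (color_changes c s <= khat)%N &
      forall s' : seq J, is_schedule s' -> (color_changes c s' <= khat)%N ->
        temp_change t s <= temp_change t s'].

(* B is a block at its place in the sequence l ++ B ++ r: it is nonempty and
   has one color, and no longer run of consecutive jobs containing this
   occurrence of B has one color. *)
Definition is_block (J : finType) (c : J -> bool) (l B r : seq J) : Prop :=
  [/\ B <> [::], constant (map c B) &
      forall l1 l2 r1 r2 : seq J, l = l1 ++ l2 -> r = r1 ++ r2 ->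
        constant (map c (l2 ++ B ++ r1)) -> l2 = [::] /\ r1 = [::]].

Definition block_partition (J : finType) (c : J -> bool) (s : seq J)
    (bs : seq (seq J)) : Prop :=
  flatten bs = s /\
  forall i : nat, (i < size bs)%N ->
    is_block c (flatten (take i bs)) (nth [::] bs i) (flatten (drop i.+1 bs)).

(* The value 0 on the empty sequence is a dummy: blocks are nonempty. *)
Definition t_max (R : realType) (J : finType) (t : J -> R) (B : seq J) : R :=
  if B is p :: B' then \big[Order.max/t p]_(q <- B') t q else 0.

Definition t_min (R : realType) (J : finType) (t : J -> R) (B : seq J) : R :=
  if B is p :: B' then \big[Order.min/t p]_(q <- B') t q else 0.

(* sorted compares consecutive elements only. *)
Definition increasing (R : realType) (J : finType) (t : J -> R) (B : seq J) :
    bool := sorted (fun p q => t p < t q) B.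

Definition decreasing (R : realType) (J : finType) (t : J -> R) (B : seq J) :
    bool := sorted (fun p q => t p > t q) B.

Definition same_color (J : finType) (c : J -> bool) (B B' : seq J) : Prop :=
  forall p q : J, p \in B -> q \in B' -> c p = c q.

(* Main.v *)
(* Process temperatures are points on a line and a schedule is a walk visiting them.
   If every temperature level strictly inside the range [m, M] is crossed at least
   twice, the walk costs at least 2 (M - m), which pays for sorting one color
   downwards and then the other one upwards. Otherwise some level is crossed once and
   cuts the schedule, up to reversal, into a colder and a hotter part. The colder part
   is a walk with a prescribed final temperature and color: again either all its
   levels are crossed twice, and one color down and then the other one up is as good,
   or it is cut. The pieces that remain in the middle have both ends prescribed; there
   levels are crossed an odd number of times, and a cost of 3 (M - m) pays for sorting
   one color upwards, jumping back, and sorting the other one upwards. So any schedule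
   can be rearranged, without increasing the temperature change or the number of
   color changes, into D ++ W ++ E where D and E are decreasing blocks (possibly
   empty) and both colors increase along W. *)
Require Import Defs.
From HB Require Import structures.
From mathcomp Require Import all_boot all_order all_algebra.
From mathcomp Require Import reals.
From mathcomp Require Import ring.

Set Implicit Arguments.
Unset Strict Implicit.
Unset Printing Implicit Defensive.

Import Order.TTheory GRing.Theory Num.Theory.

Local Open Scope ring_scope.

(** * Auxiliary facts on sequences *)

Lemma pairwise_rev (T : Type) (r : rel T) (s : seq T) :
  pairwise r (rev s) = pairwise (fun x y => r y x) s.
Proof.
elim: s => //= x s IH; rewrite rev_cons -cats1 pairwise_cat IH /= andbT.
by rewrite allrel1r all_rev.
Qed.

(** Usually applied at a temperature level, with [a] meaning below it: either the cold elements all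
    precede the hot ones, or a hot one precedes a cold one, a pattern that forces further crossings
    of the level. *)
Lemma split_or_inversion (T : eqType) (a : pred T) (s : seq T) :
  (exists s1 s2, [/\ s = s1 ++ s2, all a s1 & all (predC a) s2]) \/
  subseq [:: false; true] (map a s).
Proof.
elim: s => [|x s IH]; first by left; exists [::], [::].
case: (boolP (a x)) => ax /=.
  case: IH => [[s1 [s2 [-> a1 a2]]]|sub]; last by right; rewrite ax /=.
  by left; exists (x :: s1), s2; rewrite /= ax.
rewrite (negPf ax) /= sub1seq.
case: (boolP (has a s)) => [/hasP[y ys ay]|nas].
  by right; rewrite -ay map_f.
by left; exists [::], (x :: s); rewrite /= ax all_predC.
Qed.

Lemma seq_argmin (R : realDomainType) (T : eqType) (f : T -> R) (s : seq T) :
  s != [::] -> exists2 x, x \in s & forall y, y \in s -> f x <= f y.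
Proof.
elim: s => // x [_ _|y s /(_ isT) [z zs zmin] _].
  by exists x; rewrite ?mem_head // => y; rewrite inE => /eqP ->.
case: (leP (f x) (f z)) => [xz|/ltW zx].
  exists x; rewrite ?mem_head // => u; rewrite in_cons => /orP[/eqP->//|us].
  exact: le_trans xz (zmin _ us).
exists z; first by rewrite in_cons zs orbT.
by move=> u; rewrite in_cons => /orP[/eqP->//|]; apply: zmin.
Qed.

(** * Total variation of a sequence of numbers *)

Section Variation.
Variable R : realDomainType.
Implicit Types (s : seq R) (x y a b v m M : R).

Definition variation s : R := \sum_(e <- zip s (behead s)) `|e.2 - e.1|.

Lemma variation1 x : variation [:: x] = 0.
Proof. by rewrite /variation big_nil. Qed.

Lemma variation_cons x y s :
  variation (x :: y :: s) = `|y - x| + variation (y :: s).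
Proof. by rewrite /variation /= big_cons. Qed.

Lemma variation_ge0 s : 0 <= variation s.
Proof. by apply: sumr_ge0 => e _; apply: normr_ge0. Qed.

Lemma variation_cat s1 x s2 :
  variation (s1 ++ x :: s2) = variation (rcons s1 x) + variation (x :: s2).
Proof.
elim: s1 => [|y [|z s1] IH] /=; first by rewrite variation1 add0r.
  by rewrite !variation_cons variation1 addr0.
by rewrite !variation_cons IH addrA.
Qed.

Lemma variation_rcons x y s :
  variation (rcons (rcons s x) y) = variation (rcons s x) + `|y - x|.
Proof.
by rewrite -cats1 cat_rcons variation_cat variation_cons
           variation1 addr0.
Qed.

Lemma variation_rev s : variation (rev s) = variation s.
Proof.
elim: s => // x [//|y s]; rewrite variation_cons => <-.
rewrite 2!rev_cons -[in LHS]cats1 cat_rcons variation_cat variation_cons.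
by rewrite variation1 addr0 -rev_cons distrC addrC.
Qed.

Lemma variation_insert x y s : variation (x :: s) <= variation (x :: y :: s).
Proof.
case: s => [|z s]; first by rewrite variation1 variation_ge0.
rewrite !variation_cons addrA lerD2r.
by rewrite -(subrKA y) addrC; apply: ler_normD.
Qed.

Lemma variation_behead x s : variation s <= variation (x :: s).
Proof.
case: s => [|y s]; first by rewrite variation1 /variation big_nil.
by rewrite variation_cons lerDr normr_ge0.
Qed.

Lemma variation_cons_subseq x s1 s2 :
  subseq s1 s2 -> variation (x :: s1) <= variation (x :: s2).
Proof.
elim: s2 x s1 => [|y s2 IH] x [|z s1] //=.
  by rewrite variation1 variation_ge0.
case: eqP => [->|_] sub; first by rewrite !variation_cons lerD2l IH.
exact: le_trans (IH _ _ sub) (variation_insert _ _ _).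
Qed.

(** Leaving out points never lengthens a walk, by the triangle inequality. Upper bounds below come
    from inserting turning points, lower bounds from keeping only some points. *)
Lemma variation_subseq s1 s2 : subseq s1 s2 -> variation s1 <= variation s2.
Proof.
elim: s2 s1 => [|y s2 IH] [|x s1] //= sub.
  by rewrite {1}/variation big_nil variation_ge0.
case: eqP sub => [->|_] sub; first exact: variation_cons_subseq.
exact: le_trans (IH _ sub) (variation_behead _ _).
Qed.

(** Valid for every [v], so it recombines rearranged parts whatever their ends are; the equality
    [variation_cut] serves for the original parts. *)
Lemma variation_join v s1 s2 :
  variation (s1 ++ s2) <= variation (rcons s1 v) + variation (v :: s2).
Proof.
by rewrite -variation_cat variation_subseq // cat_subseq // subseq_cons.
Qed.

(* Equality, rather than the triangle inequality, because v separates the two parts. *)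
Lemma variation_cut v s1 s2 :
    s1 != [::] -> s2 != [::] ->
    all (fun x => x <= v) s1 -> all (fun x => v <= x) s2 ->
  variation (s1 ++ s2) = variation (rcons s1 v) + variation (v :: s2).
Proof.
case/lastP: s1 => // s1 x _; case: s2 => // y s2 _.
rewrite all_rcons /= => /andP[xv _] /andP[vy _].
rewrite variation_cat !variation_rcons variation_cons.
by rewrite !ger0_norm ?subr_ge0 ?(le_trans xv) //; ring.
Qed.

Lemma variation_rcons_above M s z :
    s != [::] -> all (fun x => x <= M) s -> M <= z ->
  variation (rcons s z) = variation (rcons s M) + (z - M).
Proof.
move=> s0 sM Mz; rewrite -cats1 (variation_cut s0 (s2 := [:: z]) _ sM) //= ?Mz //.
by rewrite variation_cons variation1 addr0 ger0_norm // subr_ge0.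
Qed.

Lemma variation_cons_below m s y :
    s != [::] -> all (fun x => m <= x) s -> y <= m ->
  variation (y :: s) = (m - y) + variation (m :: s).
Proof.
move=> s0 sm ym; rewrite -cat1s (variation_cut (s1 := [:: y]) _ s0 _ sm) //= ?ym //.
by rewrite variation_cons variation1 addr0 ger0_norm // subr_ge0.
Qed.

Lemma variation_ge_dist x y s : x \in s -> y \in s -> `|y - x| <= variation s.
Proof.
move=> xs; case/splitPr: xs => s1 s2.
rewrite mem_cat inE orbCA => /orP[/eqP->|]; first by rewrite subrr normr0 variation_ge0.
have dist u v : variation [:: u; v] = `|v - u|.
  by rewrite variation_cons variation1 addr0.
case/orP=> y_in.
  rewrite distrC -dist; apply: variation_subseq.
  by apply: (@cat_subseq _ [:: y] [:: x]); rewrite ?sub1seq // mem_head.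
rewrite -dist; apply: variation_subseq.
by apply: (@cat_subseq _ [::] [:: x; y]); rewrite ?sub0seq //= eqxx sub1seq.
Qed.

Lemma variation_opp s : variation (map -%R s) = variation s.
Proof.
elim: s => // x [|y s] IH; first by rewrite !variation1.
by rewrite /= !variation_cons -opprD normrN [_ :: map _ _]/(map -%R (y :: s)) IH.
Qed.

Lemma variation_path x s y :
  path <=%O x (rcons s y) -> variation (x :: rcons s y) = y - x.
Proof.
elim: s x => [|z s IH] x /= /andP[xz]; rewrite variation_cons ger0_norm ?subr_ge0 //.
  by rewrite variation1 addr0.
by move=> /IH ->; rewrite addrC subrKA.
Qed.

End Variation.

(** * Switches of Boolean sequences, counting both color changes and level crossings *)

Definition switches (s : seq bool) : nat :=
  \sum_(e <- zip s (behead s)) (e.2 != e.1).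

(** Reading Booleans as the integers 0 and 1 turns switches into a variation, so the facts on
    concatenation, reversal and subsequences carry over. *)
Lemma switches_variation (s : seq bool) :
  (switches s)%:Z = variation [seq (nat_of_bool b)%:Z | b <- s].
Proof.
elim: s => [|x [|y s] IH]; rewrite ?variation1 /switches /variation ?big_nil //.
rewrite /= !big_cons /= PoszD -[X in _ + X = _]/((switches (y :: s))%:Z) IH.
by case: x {IH}; case: y.
Qed.

Lemma switches1 b : switches [:: b] = 0%N.
Proof. by rewrite /switches big_nil. Qed.

Lemma switches_cons b b' s :
  switches (b :: b' :: s) = ((b' != b) + switches (b' :: s))%N.
Proof. by rewrite /switches /= big_cons. Qed.

Lemma switches_cat s1 b s2 :
  switches (s1 ++ b :: s2) = (switches (rcons s1 b) + switches (b :: s2))%N.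
Proof.
apply/eqP; rewrite -eqz_nat PoszD !switches_variation map_rcons map_cat /=.
by rewrite variation_cat.
Qed.

Lemma switches_rev s : switches (rev s) = switches s.
Proof.
by apply/eqP; rewrite -eqz_nat !switches_variation map_rev variation_rev.
Qed.

Lemma switches_subseq s1 s2 : subseq s1 s2 -> (switches s1 <= switches s2)%N.
Proof.
move=> sub; rewrite -lez_nat !switches_variation.
by apply/variation_subseq/map_subseq.
Qed.

Lemma switches_gt0 s : true \in s -> false \in s -> (0 < switches s)%N.
Proof.
move=> s1 s0; rewrite -ltz_nat switches_variation.
apply: lt_le_trans (variation_ge_dist (x := 0) (y := 1) _ _) => //.
  exact: (map_f _ s0).
exact: (map_f _ s1).
Qed.

(** The first value of [s] extends the pattern starting with the opposite value to an alternation of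
    length three. *)
Lemma switches_gt1 s :
  subseq [:: false; true] s -> subseq [:: true; false] s -> (1 < switches s)%N.
Proof.
have alt b : switches [:: b; ~~ b; b] = 2%N.
  by rewrite !switches_cons switches1; case: b.
case: s => [//|[] s] up down.
  by rewrite -(alt true) switches_subseq.
by rewrite -(alt false) switches_subseq.
Qed.

Lemma switches_run b s1 s2 :
  all (pred1 b) s1 -> switches (b :: s1 ++ s2) = switches (b :: s2).
Proof.
by elim: s1 => //= x s1 IH /andP[/eqP -> /IH]; rewrite switches_cons eqxx.
Qed.

(** * Variation measured by level crossings *)

Section Levels.
Variable R : realDomainType.
Implicit Types (s vs : seq R) (x y a b v m M : R).

(** No point lies strictly between [a] and [v], so raising the points at [a] to [v] shortens each
    crossing of this gap by exactly [v - a] and leaves every other step unchanged. *)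
Lemma variation_gap a v s :
    a < v -> all (fun x => (x == a) || (v <= x)) s ->
  variation s = variation (map (Num.max v) s) +
    (v - a) * (switches [seq x <= a | x <- s])%:R.
Proof.
move=> av; have le_a x : v <= x -> (x <= a) = false.
  by move=> vx; rewrite leNgt (lt_le_trans av vx).
elim: s => [|x [|y s] IH]; rewrite /= ?variation1 /switches ?big_nil ?mulr0 ?addr0 //.
move=> /andP[xa /[dup] sa /andP[ya _]].
rewrite /= !variation_cons (IH sa) -/(switches _) big_cons /= natrD mulrDr.
rewrite -[X in _ = X]addrACA; congr (_ + _).
case/orP: xa => [/eqP->|vx]; case/orP: ya => [/eqP->|vy];
  rewrite ?lexx ?le_a //= ?eqxx ?(max_l (ltW av)) ?max_r //.
- by rewrite !subrr normr0 mulr0 addr0.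
- rewrite !ger0_norm ?subr_ge0 ?(le_trans (ltW av)) //; ring.
- rewrite -normrN opprB -[X in _ = X + _]normrN opprB.
  rewrite !ger0_norm ?subr_ge0 ?(le_trans (ltW av)) //; ring.
- ring.
Qed.

(** A discrete coarea argument along the sorted levels: the crossings of [a] are those of the whole
    gap up to the next level. If they number at least [K], the gap contributes [K] times its length,
    and the induction continues with the points at [a] raised to the next level. *)
Lemma variation_levels_path (K : nat) a vs s :
    path <=%O a vs -> {subset s <= a :: vs} ->
  K%:R * (last a vs - a) <= variation s \/
  exists v, [/\ a <= v, v < last a vs &
    (switches [seq (x <= v)%R | x <- s] < K)%N].
Proof.
elim: vs a s => [|v vs IH] a s /=.
  by left; rewrite subrr mulr0 variation_ge0.
move=> /andP[av pvs] sub.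
have v_last : v <= last v vs.
  have /allP := order_path_min le_trans pvs.
  by case: (vs) => //= u us; apply; apply: mem_last.
have [eq_av|lt_av] := eqVneq a v.
  by rewrite eq_av; apply: IH => // x /sub; rewrite eq_av !inE orbA orbb.
have {lt_av}av : a < v by rewrite lt_neqAle lt_av.
case: (ltnP (switches [seq (x <= a)%R | x <- s]) K) => [lt_K|ge_K].
  by right; exists a; rewrite lexx (lt_le_trans av).
have sa : all (fun x => (x == a) || (v <= x)) s.
  apply/allP => x /sub; rewrite inE => /orP[-> //|]; rewrite inE => /orP[/eqP->|].
    by rewrite lexx orbT.
  by move=> /(allP (order_path_min le_trans pvs)) ->; rewrite orbT.
have sub' : {subset map (Num.max v) s <= v :: vs}.
  move=> _ /mapP[x xs ->]; have := allP sa _ xs; have := sub _ xs.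
  rewrite inE; case: (x =P a) => [-> _ _|_ /= xvs vx].
    by rewrite max_l ?mem_head // ltW.
  by rewrite max_r.
case: (IH v _ pvs sub') => [le_var|[u [vu u_last lt_K]]].
  left; rewrite (variation_gap av sa) -(subrKA v) addrC mulrDr addrC lerD //.
  by rewrite mulrC ler_wpM2l ?ler_nat // subr_ge0 ltW.
(* For [u >= v], the conditions [max v x <= u] and [x <= u] agree, so raising points to [v] does not
   alter the crossings of [u]. *)
right; exists u; split => //; first exact: le_trans (ltW av) vu.
move: lt_K; rewrite -map_comp; congr (switches _ < K)%N.
by apply: eq_map => x /=; rewrite ge_max vu.
Qed.

(** The levels to run through are the values of [s], sorted and closed off by [b]. *)
Lemma variation_levels (K : nat) a b s :
    a <= b -> all (fun x => a <= x <= b) s ->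
  K%:R * (b - a) <= variation s \/
  exists v, [/\ a <= v, v < b & (switches [seq (x <= v)%R | x <- s] < K)%N].
Proof.
move=> ab s_ab; pose vs := rcons (sort <=%O s) b.
have last_vs : last a vs = b by rewrite last_rcons.
rewrite -last_vs; apply: variation_levels_path; last first.
  by move=> x xs; rewrite inE mem_rcons inE mem_sort xs !orbT.
rewrite path_sortedE; last exact: le_trans.
rewrite all_rcons ab all_sort (sub_all _ s_ab) /=; last by move=> x /andP[].
rewrite sorted_pairwise; last exact: le_trans.
rewrite /vs -cats1 pairwise_cat allrel1r all_sort (sub_all _ s_ab) /=; last first.
  by move=> x /andP[].
by rewrite andbT -sorted_pairwise ?sort_le_sorted //; apply: le_trans.
Qed.

End Levels.

(** * Switches of concatenated sequences *)

(** Each run is absorbed by one inserted element of its color; the runs may be empty, whence only an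
    inequality. *)
Lemma switches_runs b b' s1 s2 s3 :
    all (pred1 b) s1 -> all (pred1 b') s2 ->
  (switches (s1 ++ s2 ++ s3) <= switches [:: b, b' & s3])%N.
Proof.
move=> s1b s2b'.
have sub : subseq (s1 ++ s2 ++ s3) ((b :: s1) ++ b' :: s2 ++ s3).
  by rewrite cat_subseq ?subseq_cons.
apply: leq_trans (switches_subseq sub) _.
rewrite switches_cat -cats1 /= switches_run // switches_run //.
by rewrite !switches_cons switches1 addn0.
Qed.

Lemma switches_join b s1 s2 :
  (switches (s1 ++ s2) <= switches (rcons s1 b) + switches (b :: s2))%N.
Proof.
by rewrite -switches_cat switches_subseq // cat_subseq // subseq_cons.
Qed.

(** The doubled [b] is free: one copy acts as the prescribed final color of the first part, another
    as the prescribed initial color of the second, so that the parts can be rearranged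
    independently. *)
Lemma switches_cut b s1 s2 :
  switches (s1 ++ b :: s2) = (switches (rcons s1 b) + switches [:: b, b & s2])%N.
Proof. by rewrite switches_cat switches_cons eqxx. Qed.

(** * Rearranging a schedule without raising either cost *)

Section Arrangement.
Variables (R : realDomainType) (J : eqType) (c : J -> bool).
Implicit Types (t : J -> R) (s D W E : seq J) (v w m M : R) (p q b : bool).

Definition temp_sort t s := sort (fun x y => t x <= t y) s.

(** Between jobs of different blocks this is the weak form of property b); jobs of different colors
    are left unconstrained. *)
Definition color_le t : rel J := fun x y => (c x == c y) ==> (t x <= t y).

(* Vacuous if D is empty, and false if W is empty but D is not. *)
Definition switch_after D W := all (fun x => c x != c (head x W)) D.

Definition switch_before W E := all (fun x => c x != c (last x W)) E.

Lemma temp_sort_pairwise t s : pairwise (fun x y => t x <= t y) (temp_sort t s).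
Proof.
rewrite -sorted_pairwise; last by move=> y x z; apply: le_trans.
by apply: sort_sorted => x y; apply: le_total.
Qed.

Lemma temp_sort_color_le t s : pairwise (color_le t) (temp_sort t s).
Proof.
apply: sub_pairwise (temp_sort_pairwise t s) => x y le_xy.
by rewrite /color_le le_xy implybT.
Qed.

Lemma variation_temp_sort t s m M :
    m <= M -> all (fun x => m <= t x <= M) s ->
  variation (m :: rcons (map t (temp_sort t s)) M) = M - m.
Proof.
move=> mM s_mM; apply: variation_path.
have sM x : x \in s -> m <= t x <= M by move/(allP s_mM).
rewrite path_sortedE; last exact: le_trans.
rewrite all_rcons mM all_map all_sort (sub_all _ s_mM) /=; last by move=> x /andP[].
rewrite sorted_pairwise; last exact: le_trans.
rewrite -cats1 pairwise_cat allrel1r all_map all_sort (sub_all _ s_mM) /=; last first.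
  by move=> x /andP[].
by rewrite andbT pairwise_map; apply: sub_pairwise (temp_sort_pairwise t s).
Qed.

Lemma map_temp_sort_color t s b :
  all (fun x => c x == b) s -> map c (temp_sort t s) = map c s.
Proof.
move=> sb; have sb' : all (fun x => c x == b) (temp_sort t s) by rewrite all_sort.
have /all_pred1P -> : all (pred1 b) (map c (temp_sort t s)) by rewrite all_map.
have /all_pred1P -> : all (pred1 b) (map c s) by rewrite all_map.
by rewrite !size_map size_sort.
Qed.

Lemma temp_bounds t s : s != [::] ->
  exists m M, [/\ all (fun x => m <= t x <= M) s, m <= M,
    m \in map t s & M \in map t s].
Proof.
move=> s0; have [x xs xmin] := seq_argmin t s0.
have [y ys ymax] := seq_argmin (fun x => - t x) s0.
exists (t x), (t y); rewrite !map_f //; split => //; last exact: xmin.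
by apply/allP => u us; rewrite xmin // -lerN2 ymax.
Qed.

Let color_part t s b := temp_sort t [seq x <- s | c x == b].

Lemma perm_color_parts t s b :
  perm_eq (color_part t s b ++ color_part t s (~~ b)) s.
Proof.
have -> : color_part t s (~~ b) =
    temp_sort t [seq x <- s | predC (fun x => c x == b) x].
  by congr temp_sort; apply: eq_filter => x /=; case: (c x); case: b.
apply: perm_trans (permEl (perm_filterC (fun x => c x == b) s)).
by apply: perm_cat; rewrite perm_sort.
Qed.

Lemma color_part_color t s b : all (pred1 b) (map c (color_part t s b)).
Proof. by rewrite all_map all_sort; apply: filter_all. Qed.

Lemma color_part_bounds t s b m M :
  all (fun x => m <= t x <= M) s ->
  all (fun x => m <= t x <= M) [seq x <- s | c x == b].
Proof.
by move=> s_mM; rewrite all_filter; apply: sub_all s_mM => x /= ->; rewrite implybT.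
Qed.

Lemma allrel_color_parts t t' t'' s s' b :
  allrel (color_le t) (color_part t' s b) (color_part t'' s' (~~ b)).
Proof.
apply/allrelP => x y.
rewrite !mem_sort !mem_filter => /andP[/eqP cx _] /andP[/eqP cy _].
by rewrite /color_le cx cy; case: b {cx cy}.
Qed.

(** The stretches from [y] up to [m] and from [M] up to [z] are unavoidable; only the walk inside
    the range is left to improve. *)
Lemma variation_ends (y z m M : R) (s : seq R) :
    s != [::] -> all (fun x => m <= x <= M) s -> y <= m -> M <= z ->
  variation (y :: rcons s z) = (m - y) + variation (m :: rcons s M) + (z - M).
Proof.
move=> s0 s_mM ym Mz.
have sm : all (fun x => m <= x) s by apply: sub_all s_mM => x /andP[].
have sM : all (fun x => x <= M) s by apply: sub_all s_mM => x /andP[].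
have mM : m <= M by case: (s) s0 s_mM => //= x ? _ /andP[/andP[/le_trans h /h]].
rewrite (variation_cons_below (m := m)) //.
- by rewrite -rcons_cons (variation_rcons_above (M := M)) //= ?mM // addrA.
- by rewrite -size_eq0 size_rcons.
- by rewrite all_rcons sm (le_trans mM).
Qed.

(** This treats the middle pieces: [y], [p] and [z], [q] are the temperatures and colors prescribed
    at the two ends. The induction is on the number of jobs, which drops whenever a level cuts the
    piece. *)
Lemma ascending_between t s (y z : R) p q :
    all (fun x => y <= t x <= z) s -> y <= z ->
  exists s', [/\ perm_eq s' s, pairwise (color_le t) s',
    variation (y :: rcons (map t s') z) <= variation (y :: rcons (map t s) z) &
    (switches (p :: rcons (map c s') q) <= switches (p :: rcons (map c s) q))%N].
Proof.
have [n] := ubnP (size s); elim: n s y z p q => // n IH s y z p q.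
rewrite ltnS => size_s s_yz yz.
have [->|s0] := eqVneq s [::]; first by exists [::].
have [sp|] := boolP (all (fun x => c x == p) s).
  exists (temp_sort t s); rewrite (map_temp_sort_color t sp) perm_sort; split => //.
    exact: temp_sort_color_le.
  rewrite variation_temp_sort //.
  rewrite -(ger0_norm (_ : 0 <= z - y)) ?subr_ge0 //.
  by rewrite variation_ge_dist ?mem_head // inE mem_rcons mem_head orbT.
(* The job [x0] of the color other than [p] will account for one switch. All jobs may have that
   color; the part of color [p] is then empty. *)
rewrite -has_predC => /hasP[x0 x0s /= x0p].
have [m [M [s_mM mM ms Ms]]] := temp_bounds t s0.
have ym : y <= m by case/mapP: ms => x /(allP s_yz) /andP[? _] ->.
have Mz : M <= z by case/mapP: Ms => x /(allP s_yz) /andP[_ ?] ->.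
have all_mM : all (fun x => m <= x <= M) (m :: rcons (map t s) M).
  by rewrite /= lexx mM all_rcons mM lexx all_map.
have t_s0 : map t s != [::] by case: (s) s0.
have t_s_mM : all (fun x => m <= x <= M) (map t s) by rewrite all_map.
have eq_var := variation_ends t_s0 t_s_mM ym Mz.
case: (variation_levels 3 mM all_mM) => [var_ge|[v [mv vM sw]]].
  exists (color_part t s p ++ color_part t s (~~ p)); split.
  - exact: perm_color_parts.
  - by rewrite pairwise_cat allrel_color_parts !temp_sort_color_le.
  - rewrite eq_var map_cat rcons_cat.
    set P := map t _; set Q := map t _.
    (* The walk is compared with the one climbing to [M], dropping back to [m] and climbing to [z];
       inside the range this costs three times [M - m]. *)
    have sub : subseq (y :: P ++ rcons Q z) ((y :: P) ++ M :: m :: rcons Q z).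
      rewrite -cat_cons cat_subseq //.
      exact: subseq_trans (subseq_cons _ _) (subseq_cons _ _).
    apply: le_trans (variation_subseq sub) _.
    rewrite variation_cat rcons_cons variation_temp_sort ?(le_trans ym) //; last first.
      apply: sub_all (color_part_bounds p s_mM) => x /andP[mx ->].
      by rewrite (le_trans ym).
    rewrite variation_cons variation_temp_sort ?(le_trans mM) //; last first.
      apply: sub_all (color_part_bounds _ s_mM) => x /andP[-> xM].
      by rewrite (le_trans xM).
    rewrite distrC ger0_norm ?subr_ge0 //.
    have -> : M - y + (M - m + (z - m)) = m - y + 3 * (M - m) + (z - M) by ring.
    by rewrite lerD2r lerD2l.
  (* The color [p] comes first and merges with the prescribed start, so the switches are at most
     those of [p], [~~ p], [q], a pattern already present through [x0]. *)
  - rewrite map_cat rcons_cat -cats1 -!cat_cons.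
    apply: leq_trans (switches_runs (b := p) (b' := ~~ p) _ _ _) _.
    + by rewrite /= eqxx color_part_color.
    + exact: color_part_color.
    apply: switches_subseq; rewrite /= eqxx -cats1 -cat1s cat_subseq //.
    by rewrite sub1seq; apply/mapP; exists x0 => //; case: (c x0) x0p; case: (p).
have [[s1 [s2 [s_eq s1v s2v]]]|inv] := split_or_inversion (fun x => t x <= v) s.
  have s1_0 : s1 != [::].
    apply/eqP => s1_0; move: ms; rewrite s_eq s1_0 => /mapP[x /(allP s2v) /=].
    by move=> /negP h mx; apply: h; rewrite -mx.
  case: s2 s2v s_eq => [_ s_eq|x s2 s2v s_eq].
    move: Ms; rewrite s_eq cats0 => /mapP[x /(allP s1v) /=].
    by move=> + Mx; rewrite -Mx leNgt vM.
  have s1_yv : all (fun x => y <= t x <= v) s1.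
    apply/allP => u us; rewrite (allP s1v) // andbT.
    by have /(allP s_yz)/andP[] : u \in s by rewrite s_eq mem_cat us.
  have s2_vz : all (fun x => v <= t x <= z) (x :: s2).
    apply/allP => u us; have /= := allP s2v _ us; rewrite -ltNge => /ltW -> /=.
    by have /(allP s_yz)/andP[] : u \in s by rewrite s_eq mem_cat us orbT.
  have size1 : (size s1 < n)%N.
    by apply: leq_trans size_s; rewrite s_eq size_cat -addn1 leq_add2l.
  have size2 : (size (x :: s2) < n)%N.
    apply: leq_trans size_s; rewrite s_eq size_cat -add1n leq_add2r.
    by rewrite lt0n size_eq0.
  (* The level [v] and the color of the first job [x] above the cut become the prescribed end of the
     lower part and start of the upper part. *)
  have [s1' [perm1 asc1 var1 sw1]] :=
    IH s1 y v p (c x) size1 s1_yv (le_trans ym mv).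
  have [s2' [perm2 asc2 var2 sw2]] :=
    IH (x :: s2) v z (c x) q size2 s2_vz (le_trans (ltW vM) Mz).
  exists (s1' ++ s2'); split.
  - by rewrite s_eq perm_cat.
  - rewrite pairwise_cat asc1 asc2 !andbT; apply/allrelP => u u' us us'.
    rewrite /color_le (le_trans (y := v)) ?implybT //.
      by apply: (allP s1v); rewrite -(perm_mem perm1).
    by have /(allP s2_vz)/andP[] : u' \in x :: s2 by rewrite -(perm_mem perm2).
  - rewrite s_eq !map_cat !rcons_cat -!cat_cons.
    rewrite [leRHS](variation_cut (v := v)) ?map_cons //.
    + by apply: le_trans (variation_join v _ _) _; apply: lerD.
    + by rewrite /= (le_trans ym mv) all_map.
    + rewrite all_rcons (le_trans (ltW vM) Mz) -map_cons all_map.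
      by apply: sub_all s2_vz => u /andP[].
  - rewrite s_eq !map_cat !rcons_cat -!cat_cons switches_cut.
    by apply: leq_trans (switches_join (c x) _ _) _; apply: leq_add.
(* With the ends [m] below and [M] above [v], an inversion forces three crossings. *)
have : (switches [:: true; false; true; false] < 3)%N.
  apply: leq_ltn_trans sw; apply: switches_subseq.
  rewrite /= mv eqxx map_rcons -cats1.
  rewrite -[[:: false; true; false]]/([:: false; true] ++ [:: false]).
  rewrite cat_subseq //; last by rewrite leNgt vM.
  by rewrite -map_comp.
by rewrite !switches_cons switches1.
Qed.

(** The two switch conditions make [D] and [E] monochromatic and different in color from the
    adjacent end of [W], so each of them, if nonempty, is a whole block. *)
Definition arranged t D W E :=
  [&& pairwise (fun x y => t y <= t x) D, pairwise (fun x y => t y <= t x) E,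
      pairwise (color_le t) W, allrel (color_le t) D (W ++ E),
      allrel (color_le t) W E, switch_after D W & switch_before W E].

Lemma color_dichotomy s :
  (exists b, all (fun x => c x == b) s) \/ forall b, b \in map c s.
Proof.
have [|not_true] := boolP (true \in map c s).
  have [? ? |not_false _] := boolP (false \in map c s); first by right; case.
  left; exists true; apply/allP => x xs.
  by move: (map_f c xs) not_false; case: (c x) => // ->.
left; exists false; apply/allP => x xs.
by move: (map_f c xs) not_true; case: (c x) => // ->.
Qed.

Lemma arranged_mono t s : arranged t [::] (temp_sort t s) [::].
Proof. by rewrite /arranged /= temp_sort_color_le allrel0r. Qed.

(** The presence of color [p] keeps the second part nonempty, as [switch_after] requires when the
    first one is nonempty. *)
Lemma arranged_two_blocks t s p : p \in map c s ->
  arranged t (rev (color_part t s (~~ p))) (color_part t s p) [::].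
Proof.
move=> ps; rewrite /arranged /= temp_sort_color_le cats0 pairwise_rev.
rewrite temp_sort_pairwise allrel0r /= andbT.
apply/andP; split.
  by have := allrel_color_parts t t t s s (~~ p); rewrite negbK /allrel all_rev.
rewrite /switch_after all_rev.
have part_p : all (pred1 p) (map c (color_part t s p)) := color_part_color t s p.
have : color_part t s p != [::].
  case/mapP: ps => x xs px; have : x \in color_part t s p.
    by rewrite mem_sort mem_filter -px eqxx.
  by case: (color_part t s p).
case: (color_part t s p) part_p => //= y ? /andP[/eqP -> _] _.
rewrite all_sort; apply: sub_all (filter_all _ _) => x /= /eqP ->.
by case: p {ps}.
Qed.

Lemma perm_two_blocks t s p :
  perm_eq (rev (color_part t s (~~ p)) ++ color_part t s p) s.
Proof.
rewrite -{2}[p]negbK; apply: perm_trans (perm_color_parts t s (~~ p)).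
by apply: perm_cat; rewrite ?perm_rev.
Qed.

(** The walk is part of one going from [M] down to [m] and then up to [w]. *)
Lemma variation_two_blocks t s p m M w :
    m <= M -> M <= w -> all (fun x => m <= t x <= M) s ->
  variation (rcons (map t (rev (color_part t s (~~ p)) ++ color_part t s p)) w)
    <= (M - m) + (w - m).
Proof.
move=> mM Mw s_mM; rewrite map_cat map_rev rcons_cat.
set P := map t _; set Q := map t _.
have sub : subseq (rev P ++ rcons Q w) ((M :: rev P) ++ m :: rcons Q w).
  by apply: cat_subseq; apply: subseq_cons.
apply: le_trans (variation_subseq sub) _; rewrite variation_cat.
have -> : rcons (M :: rev P) m = rev (m :: rcons P M).
  by rewrite rev_cons rev_rcons.
rewrite variation_rev !variation_temp_sort ?(le_trans mM) //.
  apply: sub_all (color_part_bounds _ s_mM) => x /andP[-> xM].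
  exact: le_trans xM Mw.
exact: color_part_bounds.
Qed.

Lemma switches_two_blocks t s p l :
  (switches (map c (rev (color_part t s (~~ p)) ++ color_part t s p) ++ l)
   <= switches [:: ~~ p, p & l])%N.
Proof.
rewrite map_cat -catA; apply: switches_runs; last exact: color_part_color.
by rewrite map_rev all_rev; apply: color_part_color.
Qed.

Lemma switch_after_cat D W W' : switch_after D W -> switch_after D (W ++ W').
Proof. by case: W => //; case: D => //= d D; rewrite /switch_after /= eqxx. Qed.

(** This treats an initial piece: its start is free, while the temperature [w] and the color [p]
    that follow it are prescribed. Hence a decreasing block may arise only in front. *)
Lemma free_start t s w p :
    all (fun x => t x <= w) s ->
  exists D W, [/\ perm_eq (D ++ W) s, arranged t D W [::],
    variation (rcons (map t (D ++ W)) w) <= variation (rcons (map t s) w) &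
    (switches (rcons (map c (D ++ W)) p) <= switches (rcons (map c s) p))%N].
Proof.
have [n] := ubnP (size s); elim: n s w p => // n IH s w p.
rewrite ltnS => size_s s_w.
have [->|s0] := eqVneq s [::]; first by exists [::], [::].
have [m [M [s_mM mM ms Ms]]] := temp_bounds t s0.
have Mw : M <= w by case/mapP: Ms => x /(allP s_w) ? ->.
have [[b sb]|colors] := color_dichotomy s.
  exists [::], (temp_sort t s); rewrite /= (map_temp_sort_color t sb).
  rewrite perm_sort arranged_mono; split => //.
  apply: le_trans (variation_behead m _) _.
  rewrite variation_temp_sort ?(le_trans mM) //; last first.
    by apply: sub_all s_mM => x /andP[-> /le_trans->].
  rewrite -(ger0_norm (_ : 0 <= w - m)) ?subr_ge0 ?(le_trans mM) //.
  by rewrite variation_ge_dist // mem_rcons inE ?eqxx // ms orbT.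
have t_s0 : map t s != [::] by case: (s) s0.
have t_s_M : all (fun x => x <= M) (map t s).
  by rewrite all_map; apply: sub_all s_mM => x /andP[].
have all_mM : all (fun x => m <= x <= M) (rcons (map t s) M).
  by rewrite all_rcons mM lexx all_map.
(* The final climb from [M] to [w] is unavoidable, so crossings are counted on the walk stopped at
   [M]. *)
have eq_var := variation_rcons_above t_s0 t_s_M Mw.
case: (variation_levels 2 mM all_mM) => [var_ge|[v [mv vM sw]]].
  (* Color [p] comes last, so reaching the prescribed end costs no switch; the one switch between
     the parts is forced because both colors occur. *)
  exists (rev (color_part t s (~~ p))), (color_part t s p); split.
  - exact: perm_two_blocks.
  - exact: arranged_two_blocks.
  - apply: le_trans (variation_two_blocks p mM Mw s_mM) _.
    have -> : M - m + (w - m) = 2 * (M - m) + (w - M) by ring.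
    by rewrite eq_var lerD2r.
  - rewrite -[X in (X <= _)%N]/(switches _) -cats1.
    apply: leq_trans (switches_two_blocks _ _ _ _) _.
    rewrite !switches_cons switches1 eqxx !addn0.
    apply: leq_trans (leq_b1 _) (switches_gt0 _ _); rewrite mem_rcons inE colors orbT //.
have [[s1 [s2 [s_eq s1v s2v]]]|inv] := split_or_inversion (fun x => t x <= v) s;
    last first.
  (* A hot job before a cold one, followed by the final [M], crosses [v] twice. *)
  have : (switches [:: false; true; false] < 2)%N.
    apply: leq_ltn_trans sw; apply: switches_subseq.
    rewrite map_rcons -cats1 -[[:: false; true; false]]/([:: false; true] ++ [:: false]).
    rewrite cat_subseq //; last by rewrite leNgt vM.
    by rewrite -map_comp.
  by rewrite !switches_cons switches1.
case: s2 s2v s_eq => [_ s_eq|x s2 s2v s_eq].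
  move: Ms; rewrite s_eq cats0 => /mapP[x /(allP s1v) /=].
  by move=> + Mx; rewrite -Mx leNgt vM.
have s1_0 : s1 != [::].
  apply/eqP => s1_0; move: ms; rewrite s_eq s1_0 => /mapP[y /(allP s2v) /=].
  by move=> /negP h my; apply: h; rewrite -my.
have s2_vw : all (fun x => v <= t x <= w) (x :: s2).
  apply/allP => u us; have /= := allP s2v _ us; rewrite -ltNge => /ltW -> /=.
  by apply: (allP s_w); rewrite s_eq mem_cat us orbT.
have size1 : (size s1 < n)%N.
  by apply: leq_trans size_s; rewrite s_eq size_cat -addn1 leq_add2l.
(* Only the lower part keeps a free start; the upper part has both ends prescribed and extends
   [W]. *)
have [D [W [perm1 arr1 var1 sw1]]] := IH s1 v (c x) size1 s1v.
have [s2' [perm2 asc2 var2 sw2]] :=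
  ascending_between (c x) p s2_vw (le_trans (ltW vM) Mw).
have sep y z : y \in D ++ W -> z \in s2' -> color_le t y z.
  rewrite (perm_mem perm1) (perm_mem perm2) => /(allP s1v) yv.
  move=> /(allP s2_vw) /andP[vz _].
  by rewrite /color_le (le_trans yv vz) implybT.
exists D, (W ++ s2'); rewrite catA; split.
- by rewrite s_eq perm_cat.
- case/and5P: arr1 => Ddesc _ Wasc DW /and3P[_ DsW _].
  rewrite /arranged Ddesc /= pairwise_cat Wasc asc2 !cats0 allrel_catr allrel0r.
  rewrite cats0 in DW.
  rewrite DW (switch_after_cat _ DsW) /= !andbT; apply/andP; split.
    by apply/allrelP => y z yW zs; apply: sep; rewrite // mem_cat yW orbT.
  by apply/allrelP => y z yD zs; apply: sep; rewrite // mem_cat yD.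
- rewrite s_eq (map_cat t (D ++ W)) (map_cat t s1) !rcons_cat.
  rewrite [leRHS](variation_cut (v := v)) ?map_cons //.
  + by apply: le_trans (variation_join v _ _) _; apply: lerD.
  + by case: (s1) s1_0.
  + by rewrite all_map.
  + rewrite all_rcons (le_trans (ltW vM) Mw) -map_cons all_map.
    by apply: sub_all s2_vw => u /andP[].
- rewrite s_eq (map_cat c (D ++ W)) (map_cat c s1) !rcons_cat switches_cut.
  by apply: leq_trans (switches_join (c x) _ _) _; apply: leq_add.
Qed.

(** The lower part is an initial piece. The upper part becomes one after reversing its order and
    negating temperatures, which turns its leading decreasing block into a trailing one. *)
Lemma variation_two_sides t v s1 s2 :
    s1 != [::] -> s2 != [::] ->
    all (fun x => t x <= v) s1 -> all (fun x => v <= t x) s2 ->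
  exists D W E, [/\ perm_eq (D ++ W ++ E) (s1 ++ s2), arranged t D W E,
    variation (map t (D ++ W ++ E)) <= variation (map t (s1 ++ s2)) &
    (switches (map c (D ++ W ++ E)) <= switches (map c (s1 ++ s2)))%N].
Proof.
case: s2 => // x s2 s1_0 _ s1v s2v.
have [D [W1 [perm1 arr1 var1 sw1]]] := free_start (c x) s1v.
have s2v' : all (fun y => - t y <= - v) (rev (x :: s2)).
  by rewrite all_rev; apply: sub_all s2v => y; rewrite lerN2.
have [D2 [W2 [perm2 arr2 var2 sw2]]] := free_start (c x) s2v'.
have eq_rev s : rcons (map (fun y => - t y) s) (- v) =
    map -%R (rev (v :: map t (rev s))).
  by rewrite rev_cons map_rcons -map_rev revK -map_comp.
rewrite !eq_rev revK !variation_opp !variation_rev rev_cat in var2.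
have eq_rev_c s : rcons (map c s) (c x) = rev (c x :: map c (rev s)).
  by rewrite rev_cons -map_rev revK.
rewrite !eq_rev_c revK !switches_rev rev_cat in sw2.
have {}perm2 : perm_eq (rev W2 ++ rev D2) (x :: s2).
  by rewrite -rev_cat perm_rev (permPl perm2) perm_rev.
(* Jobs on different sides of [v] are in order whatever their colors. *)
have sep y z : y \in D ++ W1 -> z \in rev W2 ++ rev D2 -> color_le t y z.
  rewrite (perm_mem perm1) (perm_mem perm2) => /(allP s1v) yv /(allP s2v) vz.
  by rewrite /color_le (le_trans yv vz) implybT.
have opp_le y z : color_le (fun y => - t y) z y = color_le t y z.
  by rewrite /color_le lerN2 eq_sym.
exists D, (W1 ++ rev W2), (rev D2).
have -> : D ++ (W1 ++ rev W2) ++ rev D2 = (D ++ W1) ++ rev W2 ++ rev D2.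
  by rewrite !catA.
split.
- exact: perm_cat.
- case/and5P: arr1 => Ddesc _ Wasc DW /and3P[_ DsW _].
  case/and5P: arr2 => D2desc _ W2asc DW2 /and3P[_ DsW2 _].
  rewrite !cats0 in DW DW2.
  apply/and5P; split => //.
  + rewrite pairwise_rev; apply: sub_pairwise D2desc => y z.
    by rewrite lerN2.
  + rewrite pairwise_cat Wasc pairwise_rev /= andbC.
    apply/andP; split.
      by apply: sub_pairwise W2asc => y z; rewrite opp_le.
    apply/allrelP => y z yW zW; apply: sep; first by rewrite mem_cat yW orbT.
    by rewrite mem_cat zW.
  + apply/allrelP => y z yD; rewrite -catA mem_cat => /orP[zW|zW].
      exact: (allrelP DW).
    by apply: sep => //; rewrite mem_cat yD.
  apply/and3P; split.
  + apply/allrelP => y z; rewrite mem_cat => /orP[yW zD|yW zD].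
      by apply: sep; rewrite mem_cat ?yW ?zD orbT.
    by rewrite -opp_le; apply: (allrelP DW2); rewrite -mem_rev.
  + exact: switch_after_cat.
  + rewrite /switch_before all_rev; apply: sub_all DsW2 => y.
    case: W2 {perm2 sep var2 sw2 W2asc DW2} => [|z W2] /=; first by rewrite eqxx.
    by rewrite rev_cons -rcons_cat last_rcons.
- rewrite (map_cat t (D ++ W1)) (map_cat t s1).
  rewrite [leRHS](variation_cut (v := v)) ?map_cons //.
  + by apply: le_trans (variation_join v _ _) _; apply: lerD.
  + by case: (s1) s1_0.
  + by rewrite all_map.
  + by rewrite -map_cons all_map.
- rewrite (map_cat c (D ++ W1)) (map_cat c s1) switches_cut.
  by apply: leq_trans (switches_join (c x) _ _) _; apply: leq_add.
Qed.

Lemma arrangement_le t s :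
  exists D W E, [/\ perm_eq (D ++ W ++ E) s, arranged t D W E,
    variation (map t (D ++ W ++ E)) <= variation (map t s) &
    (switches (map c (D ++ W ++ E)) <= switches (map c s))%N].
Proof.
have [->|s0] := eqVneq s [::]; first by exists [::], [::], [::].
have [m [M [s_mM mM ms Ms]]] := temp_bounds t s0.
have [[b sb]|colors] := color_dichotomy s.
  exists [::], (temp_sort t s), [::].
  rewrite /= cats0 (map_temp_sort_color t sb) perm_sort arranged_mono; split => //.
  apply: le_trans (variation_behead m _) _.
  apply: le_trans (_ : variation (m :: rcons (map t (temp_sort t s)) M) <= _).
    by apply: variation_subseq; rewrite /= eqxx subseq_rcons.
  rewrite variation_temp_sort // -(ger0_norm (_ : 0 <= M - m)) ?subr_ge0 //.
  exact: variation_ge_dist.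
have all_mM : all (fun x => m <= x <= M) (map t s) by rewrite all_map.
case: (variation_levels 2 mM all_mM) => [var_ge|[v [mv vM sw]]].
  (* Both ends are free, so either color may come first; [false] is an arbitrary choice. *)
  exists (rev (color_part t s (~~ false))), (color_part t s false), [::].
  rewrite cats0; split.
  - exact: perm_two_blocks.
  - exact: arranged_two_blocks.
  - apply: le_trans (variation_subseq (subseq_rcons _ M)) _.
    apply: le_trans (variation_two_blocks false mM (lexx M) s_mM) _.
    by apply: le_trans var_ge; rewrite mulr_natl mulr2n.
  - rewrite -[map c _]cats0.
    apply: leq_trans (switches_two_blocks _ _ _ _) _.
    rewrite !switches_cons switches1 !addn0.
    by apply: leq_trans (leq_b1 _) (switches_gt0 _ _).
have [xm xms xmv] : exists2 x, x \in s & t x <= v.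
  by case/mapP: ms mv => x xs -> xv; exists x.
have [xM xMs vxM] : exists2 x, x \in s & v < t x.
  by case/mapP: Ms vM => x xs -> vx; exists x.
have weak s' : all (predC (fun x => t x <= v)) s' -> all (fun x => v <= t x) s'.
  by apply: sub_all => y /=; rewrite -ltNge => /ltW.
have [[s1 [s2 [s_eq s1v s2v]]]|inv] := split_or_inversion (fun x => t x <= v) s.
  rewrite s_eq; apply: (variation_two_sides (v := v)) => //; last exact: weak.
    apply/eqP => s1_0; move: xms; rewrite s_eq s1_0 => /(allP s2v) /=.
    by rewrite xmv.
  apply/eqP => s2_0; move: xMs; rewrite s_eq s2_0 cats0 => /(allP s1v).
  by rewrite leNgt vxM.
have [[s1 [s2 [s_eq s1v s2v]]]|inv'] :=
    split_or_inversion (predC (fun x => t x <= v)) s.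
  have s2v' : all (fun x => t x <= v) s2.
    by apply: sub_all s2v => y /=; rewrite negbK.
  (* Here the hot jobs come first; reversal preserves both costs, so the reversed schedule is cut
     instead. *)
  have [] := @variation_two_sides t v (rev s2) (rev s1); rewrite ?all_rev ?weak //.
  - apply/eqP => s2_0; move: xms; rewrite s_eq -[s2]revK s2_0 cats0.
    by move=> /(allP s1v) /=; rewrite xmv.
  - apply/eqP => s1_0; move: xMs; rewrite s_eq -[s1]revK s1_0 => /(allP s2v').
    by rewrite leNgt vxM.
  move=> D [W [E [perm arr var sw']]]; exists D, W, E.
  rewrite -rev_cat -s_eq in perm var sw'.
  rewrite !map_rev variation_rev in var; rewrite !map_rev switches_rev in sw'.
  by split => //; rewrite (permPl perm) perm_rev.
(* Inversions in both directions force two crossings of [v], against its choice. *)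
have : (1 < switches (map (fun x => (t x <= v)%R) s))%N.
  apply: switches_gt1 => //; have := map_subseq negb inv'.
  rewrite -map_comp /=; congr subseq.
  by apply: eq_map => x /=; rewrite negbK.
by rewrite ltnNge -ltnS; move: sw; rewrite -map_comp => ->.
Qed.

End Arrangement.

(** * Link to the schedule costs, and relations on flattened sequences *)

Lemma temp_change_variation (R : realType) (J : finType) (t : J -> R) (s : seq J) :
  temp_change t s = variation (map t s).
Proof.
elim: s => [|x [|y s] IH]; rewrite /temp_change /variation ?big_nil //=.
by rewrite !big_cons; congr (_ + _).
Qed.

Lemma color_changes_switches (J : finType) (c : J -> bool) (s : seq J) :
  color_changes c s = switches (map c s).
Proof.
elim: s => [|x [|y s] IH]; rewrite /color_changes /switches ?big_nil //=.
by rewrite !big_cons; congr (_ + _)%N; [case: (c x); case: (c y) | exact: IH].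
Qed.

Lemma allrel_flatten (T S : Type) (r : T -> S -> bool) (s : seq T) (ss : seq (seq S)) :
  allrel r s (flatten ss) = all (allrel r s) ss.
Proof. by elim: ss => [|s' ss IH] /=; rewrite ?allrel0r // allrel_catr IH. Qed.

Lemma pairwise_flatten (T : Type) (r : rel T) (ss : seq (seq T)) :
  pairwise r (flatten ss) = all (pairwise r) ss && pairwise (allrel r) ss.
Proof.
elim: ss => //= s ss IH; rewrite pairwise_cat IH allrel_flatten.
by case: (all _ _); rewrite /= ?andbF // -andbA.
Qed.

(** * Color blocks of a sequence *)

Section Blocks.
Variables (J : finType) (c : J -> bool).
Implicit Types (s B D E : seq J) (bs : seq (seq J)).

(** A local, decidable form of [block_partition]: maximality is replaced by the color difference of
    adjacent blocks. *)
Definition color_blocks bs :=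
  [&& all (fun B => B != [::]) bs, all (fun B => constant (map c B)) bs &
      sorted (allrel (fun p q => c p != c q)) bs].

Lemma constant_mapP B :
  reflect {in B &, forall p q, c p = c q} (constant (map c B)).
Proof.
case: B => [|x B] /=; first by apply: ReflectT.
rewrite all_map; apply: (iffP allP) => [Bx p q|const p pB].
  have eq_x u : u \in x :: B -> c u = c x.
    by rewrite inE => /orP[/eqP->//|/Bx/eqP].
  by move=> /eq_x -> /eq_x ->.
by rewrite /= (const p x) ?mem_head // inE pB orbT.
Qed.

Lemma constant_all_neq (b : bool) B :
  all (fun p => c p != b) B -> constant (map c B).
Proof.
move=> /allP Bb; apply/constant_mapP => p q /Bb + /Bb.
by case: (c p); case: (c q); case: b {Bb}.
Qed.

Lemma color_blocks_cons D bs :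
    D != [::] -> color_blocks bs -> switch_after c D (flatten bs) ->
  color_blocks (D :: bs).
Proof.
move=> D0 /and3P[bs0 bs_const bs_sorted] sw.
rewrite /color_blocks /= D0 bs0 bs_const /=.
case: bs bs0 bs_const bs_sorted sw => [|[|x B] bs] //=.
  by case: (D) D0 => //= p D' _ _ _ _; rewrite /switch_after /= eqxx.
move=> _ /andP[Bx _] -> sw.
have -> /= : constant (map c D).
  by apply: (@constant_all_neq (c x)); apply: sub_all sw.
rewrite andbT; apply/allrelP => p q pD qB; have /= := allP sw p pD.
by rewrite (constant_mapP (x :: B) Bx q x) ?mem_head.
Qed.

Lemma color_blocks_rcons E bs :
    E != [::] -> color_blocks bs -> switch_before c (flatten bs) E ->
  color_blocks (rcons bs E).
Proof.
case/lastP: bs => [|bs B] E0.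
  by case: E E0 => //= p E _ _; rewrite /switch_before /= eqxx.
case/and3P; rewrite !all_rcons => /andP[B0 bs0] /andP[B_const bs_const] bs_sorted.
rewrite /switch_before flatten_rcons => sw.
have sorted_rcons2 : sorted (allrel (fun p q => c p != c q)) (rcons (rcons bs B) E) =
    sorted (allrel (fun p q => c p != c q)) (rcons bs B) &&
    allrel (fun p q => c p != c q) B E.
  by case: (bs) => [|B' bs'] /=; rewrite ?andbT // rcons_path last_rcons.
rewrite /color_blocks !all_rcons E0 B0 bs0 B_const bs_const sorted_rcons2 bs_sorted /=.
case/lastP: B B0 B_const sw {bs_sorted sorted_rcons2} => // B x _ B_const sw.
have {}sw : all (fun p => c p != c x) E.
  by apply: sub_all sw => p; rewrite last_cat last_rcons.
rewrite (constant_all_neq sw); apply/allrelP => p q pB qE; rewrite eq_sym.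
rewrite (constant_mapP _ B_const p x) ?(allP sw) //.
by rewrite mem_rcons mem_head.
Qed.

Lemma color_blocks_exist s : exists2 bs, flatten bs = s & color_blocks bs.
Proof.
elim: s => [|x s [[|[|y B] bs] <- bsP]]; first by exists [::].
- by exists [:: [:: x]].
- by move: bsP.
have [cxy|cxy] := eqVneq (c x) (c y); last first.
  exists ([:: x] :: (y :: B) :: bs) => //; apply: color_blocks_cons => //.
  by rewrite /switch_after /= cxy.
exists ((x :: y :: B) :: bs) => //.
case/and3P: bsP => /= bs0 /andP[yB bs_const] bs_sorted.
rewrite /color_blocks /= bs0 bs_const cxy eqxx yB /=.
case: bs {bs0 bs_const} bs_sorted => [//|B' bs] /= /andP[yB' ->].
rewrite andbT allrel_consl yB' andbT; apply/allP => q qB'.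
by rewrite cxy; apply: (allrelP yB'); rewrite ?mem_head.
Qed.

Lemma switches_color_blocks bs : color_blocks bs ->
  switches (map c (flatten bs)) = (size bs).-1.
Proof.
elim: bs => [|[|x B] bs IH]; first by rewrite /switches big_nil.
  by [].
case/and3P => /= bs0 /andP[Bx bs_const] bs_sorted; rewrite map_cat.
rewrite switches_run //.
case: bs bs0 bs_const bs_sorted IH => [|[|y B'] bs] //=; first by rewrite switches1.
move=> bs0 bs_const /andP[xy bs_sorted] IH; rewrite switches_cons IH ?add1n.
  by rewrite eq_sym (allrelP xy) ?mem_head.
exact/and3P.
Qed.

(** A longer monochromatic run would contain the last job of the preceding block or the first job of
    the next one, whose color differs. *)
Lemma color_blocks_partition bs : color_blocks bs ->
  block_partition c (flatten bs) bs.
Proof.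
case/and3P => bs0 bs_const bs_sorted; split=> // i i_lt.
have B0 j : (j < size bs)%N -> nth [::] bs j != [::].
  by move=> j_lt; apply: (allP bs0); rewrite mem_nth.
have adj j : (j.+1 < size bs)%N ->
    allrel (fun p q => c p != c q) (nth [::] bs j) (nth [::] bs j.+1).
  by move/sortedP: bs_sorted; apply.
split; first exact/eqP/B0.
  by apply: (allP bs_const); rewrite mem_nth.
move=> l1 l2 r1 r2 l_eq r_eq /constant_mapP const.
have [p pB] : exists p, p \in nth [::] bs i.
  by case: (nth _ _ _) (B0 i i_lt) => // p B _; exists p; rewrite mem_head.
have p_in : p \in l2 ++ nth [::] bs i ++ r1 by rewrite !mem_cat pB orbT.
split.
  case/lastP: l2 l_eq const p_in => // l2 q l_eq const p_in; exfalso.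
  case: i i_lt pB l_eq const p_in {r_eq} => [|i] i_lt pB l_eq const p_in.
    by move: l_eq; rewrite take0 /=; case: (l1) => //; case: (l2).
  have qB : q \in nth [::] bs i.
    move: l_eq (B0 i (ltnW i_lt)); rewrite (take_nth [::] (ltnW i_lt)).
    rewrite flatten_rcons; case/lastP: (nth _ _ _) => // B q' + _.
    rewrite -!rcons_cat => /rcons_inj[_ ->].
    by rewrite mem_rcons mem_head.
  have /eqP[] := allrelP (adj i i_lt) _ _ qB pB.
  by apply: const => //; rewrite mem_cat mem_rcons mem_head.
case: r1 r_eq const p_in => // q r1 r_eq const p_in; exfalso.
have [i1_lt|i1_ge] := ltnP i.+1 (size bs); last first.
  by move: r_eq; rewrite drop_oversize.
have qB : q \in nth [::] bs i.+1.
  move: r_eq (B0 _ i1_lt); rewrite (drop_nth [::] i1_lt) /=.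
  by case: (nth _ _ _) => // q' B [-> _] _; rewrite mem_head.
have /eqP[] := allrelP (adj i i1_lt) _ _ pB qB.
by apply: const => //; rewrite !mem_cat mem_head !orbT.
Qed.

End Blocks.

(** * Strict monotonicity and separation of blocks *)

Section Monotone_blocks.
Variables (R : realType) (J : finType) (t : J -> R) (c : J -> bool).
Hypothesis t_distinct : forall p q : J, p <> q -> c p = c q -> t p <> t q.

Let color_lt : rel J := fun p q => (c p == c q) ==> (t p < t q).

Lemma color_le_lt p q : p != q -> color_le c t p q -> color_lt p q.
Proof.
rewrite /color_le /color_lt => /eqP pq; case: eqP => //= cpq le_pq.
by rewrite lt_neqAle le_pq andbT; apply/eqP/t_distinct.
Qed.

Lemma pairwise_color_lt s :
  uniq s -> pairwise (color_le c t) s -> pairwise color_lt s.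
Proof.
rewrite uniq_pairwise => uniq_s le_s.
have : pairwise [rel x y | (x != y) && color_le c t x y] s.
  by rewrite pairwise_relI uniq_s le_s.
by apply: sub_pairwise => p q /= /andP[]; apply: color_le_lt.
Qed.

Lemma allrel_color_lt s1 s2 :
  uniq (s1 ++ s2) -> allrel (color_le c t) s1 s2 -> allrel color_lt s1 s2.
Proof.
rewrite cat_uniq => /and3P[_ /hasPn disj _] /allrelP le12.
apply/allrelP => p q p1 q2; apply: color_le_lt; last exact: le12.
by apply: contraTneq p1 => ->; apply: disj.
Qed.

Lemma constant_increasing B :
  constant (map c B) -> pairwise color_lt B -> increasing t B.
Proof.
move=> /constant_mapP const lt_B; apply: pairwise_sorted.
apply: (sub_in_pairwise (P := mem B)) lt_B; last exact/allP.
by move=> p q pB qB; rewrite /color_lt (const p q) // eqxx.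
Qed.

Lemma constant_decreasing B :
    uniq B -> constant (map c B) -> pairwise (fun p q => t q <= t p) B ->
  decreasing t B.
Proof.
rewrite /decreasing -[sorted _ B]/(sorted (fun p q => t q < t p) B).
rewrite -rev_sorted -rev_uniq => uniq_B /constant_mapP const ge_B.
apply: constant_increasing.
  by apply/constant_mapP => p q; rewrite !mem_rev; apply: const.
apply: pairwise_color_lt => //; rewrite pairwise_rev.
by apply: sub_pairwise ge_B => p q le_qp; rewrite /color_le le_qp implybT.
Qed.

(** Attainment of the extrema reduces property b) to comparing two jobs. *)
Lemma t_max_mem B : B != [::] -> exists2 p, p \in B & t_max t B = t p.
Proof.
case: B => // p B _; rewrite /t_max big_seq.
apply: (big_ind (fun v => exists2 q, q \in p :: B & v = t q)).
- by exists p; rewrite ?mem_head.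
- by move=> u v [q qB ->] [q' q'B ->]; case: leP; [exists q' | exists q].
- by move=> q qB; exists q; rewrite // inE qB orbT.
Qed.

Lemma t_min_mem B : B != [::] -> exists2 p, p \in B & t_min t B = t p.
Proof.
case: B => // p B _; rewrite /t_min big_seq.
apply: (big_ind (fun v => exists2 q, q \in p :: B & v = t q)).
- by exists p; rewrite ?mem_head.
- by move=> u v [q qB ->] [q' q'B ->]; case: leP; [exists q | exists q'].
- by move=> q qB; exists q; rewrite // inE qB orbT.
Qed.

(** The middle [W] is cut into color blocks, and [D] and [E] are attached as blocks of their own.
    They sit at the two ends, so every inner block comes from [W] and increases. *)
Lemma arranged_blocks D W E :
    arranged c t D W E -> uniq (D ++ W ++ E) ->
  exists bs, [/\ flatten bs = D ++ W ++ E, color_blocks c bs,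
    (forall i, increasing t (nth [::] bs i) \/ decreasing t (nth [::] bs i)),
    (forall i, (0 < i)%N -> (i.+1 < size bs)%N -> increasing t (nth [::] bs i)) &
    pairwise (allrel color_lt) bs].
Proof.
case/and5P => D_ge E_ge W_le DWE_le /and3P[WE_le D_sw E_sw] uniq_s.
have := uniq_s; rewrite cat_uniq => /and3P[uniq_D _ uniq_WE].
have := uniq_WE; rewrite cat_uniq => /and3P[uniq_W _ uniq_E].
have DWE_lt := allrel_color_lt uniq_s DWE_le.
have WE_lt := allrel_color_lt uniq_WE WE_le.
have W_lt := pairwise_color_lt uniq_W W_le.
have [bsW bsW_eq bsWP] := color_blocks_exist c W.
have /andP[bsW_lt bsW_allrel] :
    all (pairwise color_lt) bsW && pairwise (allrel color_lt) bsW.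
  by rewrite -pairwise_flatten bsW_eq.
have bsW_inc i : increasing t (nth [::] bsW i).
  (* Beyond the last block, [nth] returns the empty sequence, which is increasing. *)
  have [i_lt|i_ge] := ltnP i (size bsW); last by rewrite nth_default.
  apply: constant_increasing; last by apply: (allP bsW_lt); rewrite mem_nth.
  by case/and3P: bsWP => _ /allP bs_const _; apply: bs_const; rewrite mem_nth.
have DW_lt : allrel color_lt D W by move: DWE_lt; rewrite allrel_catr => /andP[].
have DE_lt : allrel color_lt D E by move: DWE_lt; rewrite allrel_catr => /andP[].
have [bs1 [bs1_eq bs1P bs1_first bs1_inc bs1_lt]] : exists bs1,
    [/\ flatten bs1 = D ++ W, color_blocks c bs1,
      increasing t (nth [::] bs1 0) \/ decreasing t (nth [::] bs1 0),
      (forall i, (0 < i)%N -> increasing t (nth [::] bs1 i)) &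
      pairwise (allrel color_lt) bs1].
  have [->|D0] := eqVneq D [::]; first by exists bsW; split => //; left.
  have D_blocks : color_blocks c (D :: bsW).
    by apply: color_blocks_cons; rewrite // bsW_eq.
  exists (D :: bsW); split => //=.
  - by rewrite bsW_eq.
  - right; apply: constant_decreasing => //.
    by case/and3P: D_blocks => _ /andP[].
  - by case=> // i _; apply: bsW_inc.
  - by rewrite bsW_allrel andbT -allrel_flatten bsW_eq.
have [E0|E0] := eqVneq E [::].
  exists bs1; rewrite E0 cats0; split => //; last by move=> i ? _; apply: bs1_inc.
  by case=> // i; left; apply: bs1_inc.
have E_blocks : color_blocks c (rcons bs1 E).
  apply: color_blocks_rcons => //; rewrite bs1_eq.
  (* For empty [W] the switch condition fails on every job of [E], so the hypothesis is absurd
     there. *)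
  apply: sub_all E_sw => p; case: (W) => [|q W'] /=; first by rewrite eqxx.
  by rewrite last_cat.
exists (rcons bs1 E); split => //.
- by rewrite flatten_rcons bs1_eq catA.
- move=> i; rewrite nth_rcons; case: ltnP => _.
    by case: i => // i; left; apply: bs1_inc.
  case: eqP => _; last by left.
  right; apply: constant_decreasing => //.
  by case/and3P: E_blocks => _; rewrite all_rcons => /andP[].
- by move=> i i_gt0; rewrite size_rcons ltnS nth_rcons => ->; apply: bs1_inc.
- rewrite -cats1 pairwise_cat bs1_lt /= andbT allrel1r.
  apply/allP => B B_bs1; apply/allrelP => p q pB qE.
  have : p \in D ++ W by rewrite -bs1_eq; apply/flattenP; exists B.
  by rewrite mem_cat => /orP[pD|pW]; [apply: (allrelP DE_lt)|apply: (allrelP WE_lt)].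
Qed.

End Monotone_blocks.

(** * Existence of optimal schedules, and the conclusion *)

Lemma schedule_perm_enum (J : finType) (s : seq J) :
  is_schedule s -> perm_eq s (enum J).
Proof.
move=> s_sched; apply/allP => p _ /=; rewrite s_sched.
by rewrite (count_uniq_mem _ (enum_uniq J)) mem_enum.
Qed.

Lemma perm_schedule (J : finType) (s s' : seq J) :
  perm_eq s' s -> is_schedule s -> is_schedule s'.
Proof. by move=> /permP eq_s s_sched p; rewrite eq_s. Qed.

Lemma schedule_uniq (J : finType) (s : seq J) : is_schedule s -> uniq s.
Proof. by move=> /schedule_perm_enum/perm_uniq ->; apply: enum_uniq. Qed.

(** Schedules are the permutations of the enumerated jobs, so the minimum is taken over a finite
    nonempty list. *)
Lemma optimal_schedule_exists (R : realType) (J : finType) (t : J -> R)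
    (c : J -> bool) (khat : nat) (s : seq J) :
    is_schedule s -> (color_changes c s <= khat)%N ->
  exists s', optimal_schedule t c khat s'.
Proof.
move=> s_sched s_le.
pose L := [seq s' <- permutations (enum J) | (color_changes c s' <= khat)%N].
have inL s' : is_schedule s' -> (color_changes c s' <= khat)%N -> s' \in L.
  by move=> ? ?; rewrite mem_filter mem_permutations schedule_perm_enum // andbT.
have L0 : L != [::] by apply: contraTneq (inL s s_sched s_le) => ->.
have [s' s'L s'_min] := seq_argmin (temp_change t) L0.
move: s'L; rewrite mem_filter mem_permutations => /andP[s'_le s'_perm].
exists s'; split=> //; last by move=> s'' ? ?; apply/s'_min/inL.
move=> p; rewrite (permP s'_perm).
by rewrite (count_uniq_mem _ (enum_uniq J)) mem_enum.
Qed.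

(* The blocks B_1, ..., B_{k+1} are nth [::] bs 0, ..., nth [::] bs k. *)
Theorem theorem3p1 (R : realType) (J : finType) (t : J -> R) (c : J -> bool)
    (khat : nat)
    (J_nonempty : (0 < #|J|)%N)
    (t_pos : forall p : J, 0 < t p)
    (t_distinct : forall p q : J, p <> q -> c p = c q -> t p <> t q)
    (khat_le : (khat <= minn (num_color c false) (num_color c true) + 2)%N)
    (feasible : exists s : seq J,
      is_schedule s /\ (color_changes c s <= khat)%N) :
  exists (s : seq J) (bs : seq (seq J)) (k : nat),
    [/\ optimal_schedule t c khat s,
        block_partition c s bs,
        k = color_changes c s /\ (k <= khat)%N,
        size bs = k.+1 &
        (* a) *)
        ((forall i : nat, (i <= k)%N ->
            increasing t (nth [::] bs i) \/ decreasing t (nth [::] bs i)) /\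
         (forall i : nat, (0 < i < k)%N -> increasing t (nth [::] bs i))) /\
        (* b) *)
        (forall r u : nat, (r < u)%N -> (u <= k)%N ->
           same_color c (nth [::] bs r) (nth [::] bs u) ->
           t_max t (nth [::] bs r) < t_min t (nth [::] bs u))].
Proof.
have [s0 [s0_sched s0_le]] := feasible.
have [s [s_sched s_le s_min]] := optimal_schedule_exists t s0_sched s0_le.
(* Rearranging an optimal schedule raises neither cost, so the result is optimal too. *)
have [D [W [E [perm arr var sw]]]] := arrangement_le c t s.
have s'_sched := perm_schedule perm s_sched.
have [bs [bs_eq bsP bs_mono bs_inc bs_lt]] :=
  arranged_blocks t_distinct arr (schedule_uniq s'_sched).
(* The block count exceeds the switches by one only if there is a block, which the existence of a
   job ensures. *)
have bs_size : size bs = (color_changes c (D ++ W ++ E)).+1.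
  rewrite color_changes_switches -bs_eq switches_color_blocks // prednK //.
  case: bs bs_eq {bsP bs_mono bs_inc bs_lt} => //= s'_eq.
  case/card_gt0P: J_nonempty => p _.
  by have := s'_sched p; rewrite -s'_eq.
have s'_le : (color_changes c (D ++ W ++ E) <= khat)%N.
  by apply: leq_trans s_le; rewrite !color_changes_switches.
exists (D ++ W ++ E), bs, (color_changes c (D ++ W ++ E)); split=> //.
- split=> // s'' s''_sched s''_le; apply: le_trans (s_min _ s''_sched s''_le).
  by rewrite !temp_change_variation.
- by rewrite -bs_eq; apply: color_blocks_partition.
split; first by split=> // i /andP[i_gt0 i_lt]; apply: bs_inc; rewrite // bs_size.
move=> r u lt_ru le_uk same.
have u_size : (u < size bs)%N by rewrite bs_size ltnS.
have bs0 i : (i < size bs)%N -> nth [::] bs i != [::].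
  by case/and3P: bsP => /allP bs0 _ _ i_lt; apply: bs0; rewrite mem_nth.
have [p p_r ->] := t_max_mem t (bs0 r (ltn_trans lt_ru u_size)).
have [q q_u ->] := t_min_mem t (bs0 u u_size).
have r_size : (r < size bs)%N := ltn_trans lt_ru u_size.
have := allrelP (pairwiseP [::] bs_lt r u r_size u_size lt_ru) p q p_r q_u.
by rewrite (same p q) // eqxx.
Qed.
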